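(* Consider the symmetric Cournot duopoly game with uncertainty: for $i=1,2$, player $i$ chooses $x_i\in[0,1/2]$, has type $\theta_i\in\Theta_1=\Theta_2=[\alpha,\beta]$ with $0\le\alpha<\beta\le1/2$, and has reward $u_i(x,\theta_i)=x_i(1-x_1-x_2)^+-\theta_ix_i$. Consider its attitude game with attitudes in $\{0,1\}$, and write $O$ for optimism (attitude $1$), $P$ for pessimism (attitude $0$), with $(PP)$ and $(OO)$ denoting the corresponding attitude pairs. Then: (1) $(PP)$ is never a Nash equilibrium. (2) $(PP)$ is Pareto efficient. (3) $(PP)$ is Pareto superior to $(OO)$. (4) $O$ is the dominant attitude if $\beta\le\max(1/3,2\alpha)$; then $(OO)$ is the only Nash equilibrium. Together with (1), (2) and (3), the condition in (4) makes the attitude game a Prisoner's Dilemma.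
   Context: Setting. With $j=3-i$, player $i$ knows $\theta_i$ but only knows that $\theta_j\in\Theta_j$; this is common knowledge. The strategy space of each player is $X_{i,o}=[0,1/2]$, and $y^+=\max\{y,0\}$. Attitudes. Player $i$ has attitude $\pi_i$ ($1$ = optimism, $0$ = pessimism). If player $i$ believes $x_j\in X_j$, she maximizes over $x_i\in X_{i,o}$ the quantity $$f_i(x_i,X_j,\theta_i,\pi_i)=\pi_i\max_{x_j\in X_j}u_i(x,\theta_i)+(1-\pi_i)\min_{x_j\in X_j}u_i(x,\theta_i).$$ Let $r_i(X_j,\theta_i;\pi_i)$ be the set of maximizers and $\psi_i(X_j;\pi_i)=\bigcup_{\theta_i\in\Theta_i}r_i(X_j,\theta_i;\pi_i)$. A pair of sets $(X_1,X_2)$ is an uncertainty equilibrium for attitudes $\pi=(\pi_1,\pi_2)$ if $X_i=\psi_i(X_j;\pi_i)$ for $i=1,2$, $j=3-i$. In this game the uncertainty equilibrium $(X_1,X_2)$ for given $\pi$ exists and is unique, and player $i$ plays the unique element $x_i(\theta_i,\pi)$ of $r_i(X_j,\theta_i;\pi_i)$. The actual reward of player $i$ is $U_i(\pi)=u_i(x_i(\theta_i,\pi),x_j(\theta_j,\pi),\theta_i)$. Attitude game. In the first stage the players choose $(\pi_1,\pi_2)\in\{0,1\}^2$; in the second stage they play the game with these attitudes and get the rewards $U_i(\pi)$ (for the actual types $\theta_1,\theta_2\in[\alpha,\beta]$). Nash equilibrium, Pareto efficiency and Pareto superiority refer to the $2\times2$ game with payoffs $U_1(\pi),U_2(\pi)$,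 $\pi\in\{0,1\}^2$. An attitude $\pi_i^*$ of player $i$ is dominant if for every $\pi_j\in\{0,1\}$ and every $\theta_j\in\Theta_j$ one has $U_i(\pi_i^*,\pi_j)\ge U_i(\pi_i,\pi_j)$ for all $\pi_i\in\{0,1\}$ (where $U_i(\pi_i,\pi_j)$ denotes the reward of player $i$ when she has attitude $\pi_i$ and the opponent $\pi_j$). Prisoner's Dilemma here means that $O$ is dominant for both players, $(OO)$ is the only Nash equilibrium, and $(PP)$ is Pareto efficient, Pareto superior to $(OO)$, and not a Nash equilibrium.
   Formalization: In (3), strict superiority excludes α=0, β=θ_1=θ_2=1/2, where the payoffs of (PP) and (OO) coincide; in (4) and the Prisoner's Dilemma, uniqueness of (OO) excludes (α,β)=(0,1/3) or (1/4,1/2) with {θ_1,θ_2}={α,β}, where a second Nash equilibrium exists. *)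

(* Defs.v *)
(* MathComp-Analysis *)
From HB Require Import structures.
From mathcomp Require Import all_boot all_order all_algebra.
From mathcomp Require Import all_classical all_reals.

Set Implicit Arguments.
Unset Strict Implicit.
Unset Printing Implicit Defensive.

Import Order.TTheory GRing.Theory Num.Theory.
Local Open Scope classical_set_scope.
Local Open Scope ring_scope.

(* The two players are the elements of 'I_2; [opponent i] is the player j <> i. *)
Definition opponent (i : 'I_2) : 'I_2 := rev_ord i.

(* The profile in which player [i] has [a] and the opponent has [b]. *)
Definition profile (T : Type) (i : 'I_2) (a b : T) : 'I_2 -> T :=
  fun k => if k == i then a else b.

Section SecondStage.
Variable R : realType.

Definition strategies : set R := [set y | 0 <= y <= 1 / 2].

Definition u (i : 'I_2) (x : 'I_2 -> R) (t : R) : R :=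
  x i * Num.max (1 - x 0 - x 1) 0 - t * x i.

(* The payoff is continuous in the opponent's strategy, so on nonempty compact
   sets [Xj] the supremum and the infimum are a maximum and a minimum. *)
Definition f (i : 'I_2) (xi : R) (Xj : set R) (t p : R) : R :=
  p * sup [set u i (profile i xi xj) t | xj in Xj]
  + (1 - p) * inf [set u i (profile i xi xj) t | xj in Xj].

Definition r (i : 'I_2) (Xj : set R) (t p : R) : set R :=
  [set xi | strategies xi /\
            forall y, strategies y -> f i y Xj t p <= f i xi Xj t p].

Definition psi (alpha beta : R) (i : 'I_2) (Xj : set R) (p : R) : set R :=
  \bigcup_(t in [set t | alpha <= t <= beta]) r i Xj t p.

Definition uncertainty_equilibrium (alpha beta : R) (p : 'I_2 -> R)
    (X : 'I_2 -> set R) : Prop :=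
  forall i, X i = psi alpha beta i (X (opponent i)) (p i).

(* [xget x0 A] is an element of [A] when [A] is nonempty, hence the element of
   [A] when [A] is a singleton; the dummy value [x0] is returned when [A] is
   empty. The equilibrium and the maximizer below exist and are unique when
   0 <= alpha < beta <= 1 / 2, p takes values in {0, 1} and
   alpha <= t <= beta. *)
Definition equilibrium (alpha beta : R) (p : 'I_2 -> R) : 'I_2 -> set R :=
  xget (fun=> set0) [set X | uncertainty_equilibrium alpha beta p X].

Definition play (alpha beta : R) (p : 'I_2 -> R) (i : 'I_2) (t : R) : R :=
  xget 0 (r i (equilibrium alpha beta p (opponent i)) t (p i)).

End SecondStage.

Section AttitudeGame.
Variable R : realType.

Definition optimism : bool := true.
Definition pessimism : bool := false.
Definition OO : 'I_2 -> bool := fun=> optimism.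
Definition PP : 'I_2 -> bool := fun=> pessimism.

Definition weight (a : bool) : R := a%:R.

(* [theta] is the profile of actual types. *)
Definition U (alpha beta : R) (theta : 'I_2 -> R) (a : 'I_2 -> bool)
    (i : 'I_2) : R :=
  u i (fun k => play alpha beta (weight \o a) k (theta k)) (theta i).

(* [ti] is the type of player [i]; the opponent's type [tj] is unknown. *)
Definition dominant (alpha beta : R) (i : 'I_2) (ti : R) (a : bool) : Prop :=
  forall (b : bool) (tj : R), alpha <= tj <= beta -> forall a' : bool,
    U alpha beta (profile i ti tj) (profile i a' b) i
    <= U alpha beta (profile i ti tj) (profile i a b) i.

(* 2 x 2 games with payoffs [V]: [V a i] is the payoff of player [i] at [a]. *)
Variable V : ('I_2 -> bool) -> 'I_2 -> R.

Definition nash (a : 'I_2 -> bool) : Prop :=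
  forall (i : 'I_2) (b : bool), V (profile i b (a (opponent i))) i <= V a i.

Definition only_nash (a : 'I_2 -> bool) : Prop :=
  forall a', nash a' <-> a' = a.

Definition pareto_superior (a a' : 'I_2 -> bool) : Prop :=
  (forall i, V a' i <= V a i) /\ (exists i, V a' i < V a i).

Definition pareto_efficient (a : 'I_2 -> bool) : Prop :=
  forall a', ~ pareto_superior a' a.

End AttitudeGame.

Definition prisoners_dilemma (R : realType) (alpha beta : R)
    (theta : 'I_2 -> R) : Prop :=
  let V := U alpha beta theta in
  [/\ forall i, dominant alpha beta i (theta i) optimism,
      only_nash V OO,
      pareto_efficient V PP,
      pareto_superior V PP OO
    & ~ nash V PP].

(* Main.v *)
(* With outputs in [0, 1/2] the price never hits zero, so the payoff of player i
   is x_i (1 - x_i - x_j - t), decreasing in x_j, and an optimist (pessimist)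
   best-responds to m = inf X_j (m = sup X_j) with the interior optimum
   (1 - t - m) / 2. Hence psi maps a set to an interval of length
   (beta - alpha) / 2, the beliefs (m_1, m_2) solve a nonsingular linear system,
   and equilibrium outputs and payoffs are explicit. Each payoff difference of
   interest then factors as (beta - alpha) / 6 times a linear form in the types,
   whose sign is read off the bounds on the types. *)
Require Import Defs.
From mathcomp Require Import all_boot all_order all_algebra.
From mathcomp Require Import all_classical all_reals.
From mathcomp Require Import ring lra.

Set Implicit Arguments.
Unset Strict Implicit.
Unset Printing Implicit Defensive.

Import Order.TTheory GRing.Theory Num.Theory.
Local Open Scope classical_set_scope.
Local Open Scope ring_scope.

(** * The two players *)

Lemma opponentK : involutive opponent.
Proof. exact: rev_ordK. Qed.

Lemma opponent_neq (i : 'I_2) : (opponent i == i) = false.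
Proof. by case: i => -[|[|]]. Qed.

Lemma profile_self (T : Type) (i : 'I_2) (a b : T) : profile i a b i = a.
Proof. by rewrite /profile eqxx. Qed.

Lemma profile_opponent (T : Type) (i : 'I_2) (a b : T) :
  profile i a b (opponent i) = b.
Proof. by rewrite /profile opponent_neq. Qed.

(** Reduces a claim about both players to an arbitrary [i] and its opponent. *)
Lemma players_ind (i : 'I_2) (P : 'I_2 -> Prop) :
  P i -> P (opponent i) -> forall k, P k.
Proof.
have [-> | ->] : i = ord0 \/ i = ord_max.
- by case: i => -[|[|//]] ?; [left|right]; apply/val_inj.
- move=> P0 P1 [[|[|//]] hk].
  + by rewrite (_ : Ordinal hk = ord0) //; apply/val_inj.
  + by rewrite (_ : Ordinal hk = opponent ord0) //; apply/val_inj.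
- move=> P1 P0 [[|[|//]] hk].
  + by rewrite (_ : Ordinal hk = opponent ord_max) //; apply/val_inj.
  + by rewrite (_ : Ordinal hk = ord_max) //; apply/val_inj.
Qed.

(** * Extrema of decreasing affine images *)

Section Sup.
Variable R : realType.
Implicit Types (X : set R) (x c : R).

Lemma sup_affine_decreasing X x c : X !=set0 -> has_lbound X -> 0 <= x ->
  sup [set c - x * y | y in X] = c - x * inf X.
Proof.
move=> X0 Xlb x0; have [y0 Xy0] := X0.
have ub : ubound [set c - x * y | y in X] (c - x * inf X).
  move=> _ [y Xy <-]; rewrite lerD2l lerN2 ler_wpM2l //.
  exact: ge_inf.
apply/eqP; rewrite eq_le; apply/andP; split.
  by apply: ge_sup => //; exists (c - x * y0), y0.
(* The reverse inequality divides by [x], so the constant image at [x = 0] is treated apart. *)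
have [x0'|x0'] := eqVneq x 0.
  apply: ub_le_sup; first by exists (c - x * inf X).
  by exists y0 => //; rewrite x0' !mul0r.
have {}x0 : 0 < x by rewrite lt_def x0'.
rewrite lerBlDr -lerBlDl -ler_pdivrMl // [leLHS]mulrC.
apply: lb_le_inf => // y Xy; rewrite ler_pdivrMr // lerBlDl [y * x]mulrC -lerBlDr.
by apply: ub_le_sup; [exists (c - x * inf X)|exists y].
Qed.

Lemma inf_affine_decreasing X x c : X !=set0 -> has_ubound X -> 0 <= x ->
  inf [set c - x * y | y in X] = c - x * sup X.
Proof.
move=> X0 [M XM] x0.
have opp_image : -%R @` [set c - x * y | y in X]
    = [set - c - x * y | y in -%R @` X].
  by rewrite !image_comp; apply: eq_imagel => y _ /=; ring.
have inf_opp : inf (-%R @` X) = - sup X.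
  rewrite /inf image_comp (eq_imagel (f' := id)) ?image_id // => y _ /=.
  by rewrite opprK.
rewrite {1}/inf opp_image sup_affine_decreasing ?inf_opp //; first by ring.
- by case: X0 => y Xy; exists (- y), y.
- by exists (- M) => _ [y /XM yM <-]; rewrite lerN2.
Qed.

End Sup.

(** * Best responses *)

Section SecondStage.
Variables (R : realType) (alpha beta : R).
Hypotheses (h_alpha : 0 <= alpha) (h_lt : alpha < beta) (h_beta : beta <= 1 / 2).
Implicit Types (i : 'I_2) (X : set R) (a b : bool) (t : R).

Lemma u_total_le1 i (x : 'I_2 -> R) t : x i + x (opponent i) <= 1 ->
  u i x t = x i * (1 - x i - x (opponent i) - t).
Proof.
move=> x_le1; rewrite /u.
have -> : 1 - x 0 - x 1 = 1 - x i - x (opponent i).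
  have opp0 : opponent 0 = 1 by apply/val_inj.
  apply: (@players_ind 0 (fun k => _ = 1 - x k - x (opponent k))) i {x_le1};
    by rewrite ?opponentK opp0 // addrAC.
by rewrite (max_idPl _); [ring|lra].
Qed.

(* The opponent's output that player [i] best-responds to. *)
Definition belief a X : R := if a then inf X else sup X.

Lemma f_belief i (x : R) X t a :
  X !=set0 -> X `<=` @strategies R -> @strategies R x ->
  f i x X t (@weight R a) = x * (1 - t - belief a X - x).
Proof.
move=> X0 Xs /andP[x0 x12].
have payoff_image : [set u i (profile i x y) t | y in X] =
    [set x * (1 - x - t) - x * y | y in X].
  apply: eq_imagel => y /Xs /andP[y0 y12].
  by rewrite (@u_total_le1 i) profile_self profile_opponent; [ring|lra].
rewrite /f payoff_image sup_affine_decreasing ?inf_affine_decreasing //.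
- by case: a; rewrite /weight /belief /=; ring.
- by exists (1 / 2) => y /Xs /andP[].
- by exists 0 => y /Xs /andP[].
Qed.

Lemma belief_bounds a X :
  X !=set0 -> X `<=` @strategies R -> 0 <= belief a X <= 1 / 2.
Proof.
move=> X0 Xs; have [y Xy] := X0; have /andP[y0 y12] := Xs _ Xy.
case: a; rewrite /belief; apply/andP; split.
- by apply: lb_le_inf => // z /Xs /andP[].
- apply: le_trans y12; apply: ge_inf => //; exists 0 => z /Xs /andP[] //.
- apply: le_trans y0 _; apply: ub_le_sup => //; exists (1 / 2) => z /Xs /andP[] //.
- by apply: ge_sup => // z /Xs /andP[].
Qed.

(** By [f_belief], the value at the vertex exceeds the value at [y] by exactly the squared distance
    from [y] to the vertex. *)
Lemma r_singleton i X t a : X !=set0 -> X `<=` @strategies R -> 0 <= t <= 1 / 2 ->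
  r i X t (@weight R a) = [set (1 - t - belief a X) / 2].
Proof.
move=> X0 Xs t_itv; have m_itv := belief_bounds a X0 Xs.
have s_opt : @strategies R ((1 - t - belief a X) / 2) by rewrite /strategies /=; lra.
apply/seteqP; split=> x /=.
  move=> [xs /(_ _ s_opt)]; rewrite !f_belief // => x_opt.
  apply/eqP; rewrite -subr_eq0 -sqrf_eq0; apply/eqP/le_anti.
  by rewrite sqr_ge0 andbT; nra.
move=> ->; split=> // y ys; rewrite !f_belief //.
have := sqr_ge0 (y - (1 - t - belief a X) / 2); nra.
Qed.

Lemma psi_itv i X a : X !=set0 -> X `<=` @strategies R ->
  psi alpha beta i X (@weight R a) =
  `[(1 - beta - belief a X) / 2, (1 - alpha - belief a X) / 2]%classic.
Proof.
have [[a0 ab] b12] := (h_alpha, h_lt, h_beta).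
move=> X0 Xs; rewrite /psi; apply/seteqP; split=> x /=.
  move=> [t /= t_itv]; rewrite r_singleton // => [->|]; last by lra.
  by rewrite in_itv /=; lra.
(* The type whose best response is [x]. *)
rewrite in_itv /= => x_itv; exists (1 - belief a X - 2 * x) => /=; first by lra.
by rewrite r_singleton //; [rewrite /=; field|lra].
Qed.

(* The belief of a player with attitude [a] against an opponent with attitude
   [b]: adjacent beliefs solve [m = (1 - beta - m') / 2 + (beta - alpha) / 2 * ~~ a]
   and the same equation with the players exchanged. *)
Definition equilibrium_belief a b : R :=
  (1 - beta) / 3 + (2 * (~~ a)%:R - (~~ b)%:R) * (beta - alpha) / 3.

(** * Existence and uniqueness of equilibrium beliefs *)

Lemma belief_segment a (l h : R) : l <= h ->
  belief a `[l, h]%classic = if a then l else h.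
Proof. by move=> lh; rewrite /belief; case: a; rewrite ?inf_itvcc ?sup_itvcc. Qed.

Lemma equilibrium_strategies (p : 'I_2 -> R) (X : 'I_2 -> set R) :
  uncertainty_equilibrium alpha beta p X -> forall i, X i `<=` @strategies R.
Proof. by move=> eqX i; rewrite eqX => x [t _ []]. Qed.

(** The equilibrium equations do not forbid empty sets outright, and [psi_itv] needs nonempty
    ones. *)
Lemma equilibrium_neq0 (c : 'I_2 -> bool) (X : 'I_2 -> set R) :
  uncertainty_equilibrium alpha beta (@weight R \o c) X -> forall i, X i !=set0.
Proof.
have [[a0 ab] b12] := (h_alpha, h_lt, h_beta).
move=> eqX i; rewrite eqX.
have [X0|X0] := eqVneq (X (opponent i)) set0.
  (* Since [sup set0 = inf set0 = 0], every strategy maximizes the zero function. *)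
  exists 0; exists alpha => /=; first by lra.
  rewrite X0; split=> [|y _]; first by rewrite /strategies /=; lra.
  by rewrite /f !image_set0 sup0 inf0 !mulr0.
move/set0P : X0 => X0; exists ((1 - beta - belief (c i) (X (opponent i))) / 2).
rewrite psi_itv //; last exact: equilibrium_strategies eqX _.
by rewrite /= in_itv /=; lra.
Qed.

Lemma belief_unique (c : 'I_2 -> bool) (X : 'I_2 -> set R) i :
  uncertainty_equilibrium alpha beta (@weight R \o c) X ->
  belief (c i) (X (opponent i)) = equilibrium_belief (c i) (c (opponent i)).
Proof.
have [[a0 ab] b12] := (h_alpha, h_lt, h_beta).
move=> eqX; have X0 := equilibrium_neq0 eqX; have Xs := equilibrium_strategies eqX.
(* An optimist reads off the lower endpoint, the output of the costliest type [beta]; a pessimist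
   reads off that of type [alpha]. *)
have step k : belief (c (opponent k)) (X k) =
    (1 - (if c (opponent k) then beta else alpha)
     - belief (c k) (X (opponent k))) / 2.
  rewrite [X in belief _ X = _]eqX psi_itv // belief_segment; last by lra.
  by case: (c (opponent k)).
have := step i; have := step (opponent i); rewrite opponentK /equilibrium_belief.
by case: (c i); case: (c (opponent i)) => /=; lra.
Qed.

Lemma equilibrium_exists (c : 'I_2 -> bool) :
  exists X : 'I_2 -> set R, uncertainty_equilibrium alpha beta (@weight R \o c) X.
Proof.
have [[a0 ab] b12] := (h_alpha, h_lt, h_beta).
pose m i := equilibrium_belief (c i) (c (opponent i)).
exists (fun i => `[(1 - beta - m i) / 2, (1 - alpha - m i) / 2]%classic) => i.
have m_itv : 0 <= m (opponent i) <= 1 / 2.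
  by rewrite /m /equilibrium_belief opponentK;
    case: (c i); case: (c (opponent i)) => /=; lra.
rewrite psi_itv.
- rewrite belief_segment; last by lra.
  suff -> : (if c i then (1 - beta - m (opponent i)) / 2
             else (1 - alpha - m (opponent i)) / 2) = m i by [].
  by rewrite /m /equilibrium_belief opponentK;
    case: (c i); case: (c (opponent i)) => /=; lra.
- exists ((1 - beta - m (opponent i)) / 2); rewrite /= in_itv /=; lra.
- by move=> y; rewrite /strategies /= in_itv /=; lra.
Qed.

(** Whichever equilibrium [xget] picks, [belief_unique] fixes the beliefs, hence the outputs. *)
Lemma play_eq (c : 'I_2 -> bool) i t : alpha <= t <= beta ->
  play alpha beta (@weight R \o c) i t =
  (1 - t - equilibrium_belief (c i) (c (opponent i))) / 2.
Proof.
have [[a0 ab] b12] := (h_alpha, h_lt, h_beta).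
move=> t_itv; rewrite /play.
have eqX : uncertainty_equilibrium alpha beta (@weight R \o c)
    (equilibrium alpha beta (@weight R \o c)).
  exact: xgetPex (equilibrium_exists c).
rewrite r_singleton.
- rewrite (belief_unique i eqX); exact: xget_unique.
- exact: equilibrium_neq0 eqX _.
- exact: equilibrium_strategies eqX _.
- by lra.
Qed.

(** * Closed-form payoffs and their comparison *)

Definition payoff ti tj a b : R :=
  let xi := (1 - ti - equilibrium_belief a b) / 2 in
  let xj := (1 - tj - equilibrium_belief b a) / 2 in
  xi * (1 - xi - xj - ti).

Lemma U_payoff (theta : 'I_2 -> R) (c : 'I_2 -> bool) i :
  (forall k, alpha <= theta k <= beta) ->
  U alpha beta theta c i =
  payoff (theta i) (theta (opponent i)) (c i) (c (opponent i)).
Proof.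
have [[a0 ab] b12] := (h_alpha, h_lt, h_beta).
move=> h_theta; have ti := h_theta i; have tj := h_theta (opponent i).
rewrite /U (@u_total_le1 i) !play_eq // opponentK //.
by rewrite /equilibrium_belief; case: (c i); case: (c (opponent i)) => /=; lra.
Qed.

Lemma payoff_PPBOO ti tj :
  payoff ti tj false false - payoff ti tj true true =
  (beta - alpha) / 6 * (1 / 3 - (ti + tj) / 2 + (alpha + beta) / 3).
Proof. by rewrite /payoff /equilibrium_belief /=; field. Qed.

Lemma payoff_PPBPO ti tj :
  payoff ti tj false false - payoff ti tj false true =
  (beta - alpha) / 6 *
  (1 - ti - (1 - tj - equilibrium_belief true false) / 2 + (beta - alpha) / 6).
Proof. by rewrite /payoff /equilibrium_belief /=; field. Qed.

Lemma payoff_OBP ti tj b :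
  payoff ti tj true b - payoff ti tj false b =
  (beta - alpha) / 6 *
  (1 / 3 - ti / 2 + tj - 5 * beta / 6 + (beta - alpha) / 3
   + (~~ b)%:R * (beta - alpha) / 6).
Proof. by rewrite /payoff /equilibrium_belief; case: b => /=; field. Qed.

(** In [payoff_PPBPO], [1 - ti] is at least [1 / 2], and the subtracted term is an output of the
    opponent, at most [1 / 2]. *)
Lemma payoff_PO_lt_PP ti tj : alpha <= ti <= beta -> alpha <= tj <= beta ->
  payoff ti tj false true < payoff ti tj false false.
Proof.
have [[a0 ab] b12] := (h_alpha, h_lt, h_beta) => ti_itv tj_itv.
rewrite -subr_gt0 payoff_PPBPO; apply: mulr_gt0; rewrite /equilibrium_belief /=; lra.
Qed.

(** From [alpha <= ti <= tj], the last factor of [payoff_OBP] is at least [(1 - beta) / 3]. *)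
Lemma payoff_PP_lt_OP ti tj : alpha <= ti <= beta -> alpha <= tj <= beta ->
  ti <= tj -> payoff ti tj false false < payoff ti tj true false.
Proof.
have [[a0 ab] b12] := (h_alpha, h_lt, h_beta) => ti_itv tj_itv tij.
rewrite -subr_gt0 payoff_OBP; apply: mulr_gt0 => /=; lra.
Qed.

(** The last factor of [payoff_PPBOO] is least at [ti = tj = beta], with value
    [(1 - 2 * beta + alpha) / 3]. *)
Lemma payoff_OO_le_PP ti tj : alpha <= ti <= beta -> alpha <= tj <= beta ->
  payoff ti tj true true <= payoff ti tj false false.
Proof.
have [[a0 ab] b12] := (h_alpha, h_lt, h_beta) => ti_itv tj_itv.
rewrite -subr_ge0 payoff_PPBOO; apply: mulr_ge0; lra.
Qed.

Lemma payoff_OO_lt_PP ti tj : alpha <= ti <= beta -> alpha <= tj <= beta ->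
  ~ [/\ alpha = 0, ti = 1 / 2 & tj = 1 / 2] ->
  payoff ti tj true true < payoff ti tj false false.
Proof.
have [[a0 ab] b12] := (h_alpha, h_lt, h_beta) => ti_itv tj_itv no_tie.
rewrite -subr_gt0 payoff_PPBOO; apply: mulr_gt0; first by lra.
by rewrite ltNge; apply/negP => tie; apply: no_tie; split; lra.
Qed.

(** The last factor of [payoff_OBP] is least at [ti = beta], [tj = alpha] against an optimist, with
    value [(1 - 3 * beta + 2 * alpha) / 3]. This is at least [2 * alpha / 3] if [beta <= 1 / 3], and
    at least [(1 - 2 * beta) / 3] if [beta <= 2 * alpha]. *)
Lemma payoff_P_le_O ti tj b : alpha <= ti <= beta -> alpha <= tj <= beta ->
  beta <= Num.max (1 / 3) (2 * alpha) ->
  payoff ti tj false b <= payoff ti tj true b.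
Proof.
have [[a0 ab] b12] := (h_alpha, h_lt, h_beta) => ti_itv tj_itv.
rewrite le_max => /orP beta_max; rewrite -subr_ge0 payoff_OBP.
by apply: mulr_ge0; [lra|case: b => /=; lra].
Qed.

Lemma payoff_P_lt_O ti tj b : alpha <= ti <= beta -> alpha <= tj <= beta ->
  beta <= Num.max (1 / 3) (2 * alpha) ->
  ~ (((alpha = 0 /\ beta = 1 / 3) \/ (alpha = 1 / 4 /\ beta = 1 / 2)) /\
     (ti = beta /\ tj = alpha)) ->
  payoff ti tj false b < payoff ti tj true b.
Proof.
have [[a0 ab] b12] := (h_alpha, h_lt, h_beta) => ti_itv tj_itv.
rewrite le_max => /orP beta_max no_tie; rewrite -subr_gt0 payoff_OBP.
apply: mulr_gt0; first by lra.
(* Against a pessimist the extra [(beta - alpha) / 6] rules out ties. *)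
case: b => /=; last by lra.
rewrite ltNge; apply/negP => tie; apply: no_tie.
by split; [case: beta_max => ?; [left|right]; split; lra|split; lra].
Qed.

End SecondStage.

(** * The attitude game *)

Theorem theorem3 (R : realType) (alpha beta : R)
    (h_alpha : 0 <= alpha) (h_lt : alpha < beta) (h_beta : beta <= 1 / 2)
    (theta : 'I_2 -> R) (h_theta : forall i, alpha <= theta i <= beta) :
  let V := U alpha beta theta in
  (* every player is indifferent between PP and OO exactly in this case *)
  let payoff_tie := alpha = 0 /\ (forall i, theta i = 1 / 2) in
  (* if beta <= max (1 / 3) (2 * alpha), then some player is indifferent between
     the two attitudes against optimism exactly in this case *)
  let attitude_tie :=
    ((alpha = 0 /\ beta = 1 / 3) \/ (alpha = 1 / 4 /\ beta = 1 / 2)) /\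
    (exists i, theta i = beta /\ theta (opponent i) = alpha) in
  [/\ (* (1) *) ~ nash V PP,
      (* (2) *) pareto_efficient V PP,
      (* (3) *) (forall i, V OO i <= V PP i) /\
                (~ payoff_tie -> pareto_superior V PP OO),
      (* (4) *) beta <= Num.max (1 / 3) (2 * alpha) ->
                [/\ forall i, dominant alpha beta i (theta i) optimism,
                    nash V OO
                  & ~ attitude_tie -> only_nash V OO]
    & (* Prisoner's Dilemma *)
      beta <= Num.max (1 / 3) (2 * alpha) -> ~ attitude_tie ->
      prisoners_dilemma alpha beta theta].
Proof.
move=> V payoff_tie attitude_tie.
have VE c i : V c i =
    payoff alpha beta (theta i) (theta (opponent i)) (c i) (c (opponent i)).
  exact: U_payoff.
have PP_not_nash : ~ nash V PP.
  (* A player whose cost is not the higher one gains by deviating to optimism. *)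
  have [i le_theta] : exists i, theta i <= theta (opponent i).
    have [?|/ltW ?] := lerP (theta 0) (theta (opponent 0)); first by exists 0.
    by exists (opponent 0); rewrite opponentK.
  move=> /(_ i true); rewrite !VE profile_self profile_opponent leNgt.
  by rewrite payoff_PP_lt_OP.
have OO_le_PP i : V OO i <= V PP i by rewrite !VE payoff_OO_le_PP.
have PP_efficient : pareto_efficient V PP.
  move=> c [PP_le [i]]; have := PP_le (opponent i); have := PP_le i.
  rewrite !VE opponentK /PP /pessimism.
  (* With exactly one optimist, the pessimist does strictly worse than at [PP]. *)
  case: (c i); case: (c (opponent i)).
  - by move=> _ _; rewrite ltNge payoff_OO_le_PP.
  - by move=> _; rewrite leNgt payoff_PO_lt_PP.
  - by rewrite leNgt payoff_PO_lt_PP.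
  - by rewrite ltxx.
have PP_superior : ~ payoff_tie -> pareto_superior V PP OO.
  move=> no_tie; split=> //; exists 0; rewrite !VE payoff_OO_lt_PP //.
  move=> [alpha0 t0 t1]; apply: no_tie; split=> // i.
  exact: (@players_ind 0 (fun k => theta k = 1 / 2)).
have O_dominant : beta <= Num.max (1 / 3) (2 * alpha) ->
    forall i, dominant alpha beta i (theta i) optimism.
  move=> beta_max i b tj tj_itv a.
  have types k : alpha <= profile i (theta i) tj k <= beta.
    by rewrite /profile; case: ifP.
  rewrite !U_payoff // !profile_self !profile_opponent.
  by case: a; rewrite // payoff_P_le_O.
have OO_nash : beta <= Num.max (1 / 3) (2 * alpha) -> nash V OO.
  move=> beta_max i b; rewrite !VE profile_self profile_opponent.
  by case: b; rewrite // payoff_P_le_O.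
have OO_only_nash : beta <= Num.max (1 / 3) (2 * alpha) -> ~ attitude_tie ->
    only_nash V OO.
  move=> beta_max no_tie c; split=> [c_nash|->]; last exact: OO_nash.
  apply: funext => i; apply/negPn/negP => /negbTE ci.
  (* A pessimist in [c] would gain strictly by switching. *)
  have := c_nash i true; rewrite !VE profile_self profile_opponent ci leNgt.
  rewrite payoff_P_lt_O // => -[params types]; apply: no_tie.
  by split=> //; exists i.
split=> // [beta_max|beta_max no_tie].
  by split; [exact: O_dominant|exact: OO_nash|exact: OO_only_nash].
split; [exact: O_dominant|exact: OO_only_nash|by []| |by []].
(* A payoff tie forces [alpha = 0] and [beta >= 1 / 2], against the bound on [beta]. *)
apply: PP_superior => -[alpha0 types]; have := h_theta 0; rewrite types.
by move: beta_max; rewrite le_max => /orP; lra.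
Qed.
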